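(* Let $N\ge 2$, $a,b,p,q>0$, $s\ge 1$, and assume $p<1$ and $ps+q<1$. Let $(u,v)$ be a positive radially symmetric solution of $$\Delta u=|x|^{a}v^{p}\ \text{ in } \mathbb{R}^N,\qquad \Delta v=|x|^{b}v^{q}|\nabla u|^{s}\ \text{ in } \mathbb{R}^N .$$ If $$\frac{p(s-2)(s+as+b+2)}{1-ps-q}\le 2(N+a-1),$$ then $$\lim_{|x|\to\infty}\frac{u(x)}{|x|^{\frac{(a+2)(1-ps-q)+ps(a+1)+bp+2p}{1-ps-q}}}=\frac{(AB^{s}K)^{\frac{p}{ps+q-1}}}{DB}$$ and $$\lim_{|x|\to\infty}\frac{v(x)}{|x|^{\frac{(a+1)s+b+2}{1-ps-q}}}=(AB^{s}K)^{\frac{1}{ps+q-1}},$$ where $$A=2+\frac{b+2q+s(1+a+2p)}{1-ps-q},\qquad B=N+a+p\Big(2+\frac{b+2q+s(1+a+2p)}{1-ps-q}\Big),$$ $$K=N+\frac{b+2q+s(1+a+2p)}{1-ps-q},\qquad D=2+a+p\Big(2+\frac{b+2q+s(1+a+2p)}{1-ps-q}\Big).$$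
   Context: A positive radially symmetric solution is a pair $(u,v)$ of positive, radially symmetric, classical ($C^2$) functions on $\mathbb{R}^N$ satisfying the system pointwise. *)

(* Defs.v *)
From HB Require Import structures.
From mathcomp Require Import all_boot all_order all_algebra.
From mathcomp Require Import all_classical all_reals all_analysis.
Set Implicit Arguments.
Unset Strict Implicit.
Unset Printing Implicit Defensive.
Import Order.TTheory GRing.Theory Num.Theory.
Import numFieldNormedType.Exports.
Local Open Scope classical_set_scope.
Local Open Scope ring_scope.

(* The library norm on 'rV[R]_n is the sup norm, which induces the usual
   topology and directional derivatives; the Euclidean norm has to be defined. *)
Definition enorm (R : realType) (n : nat) (x : 'rV[R]_n) : R :=
  Num.sqrt (\sum_(i < n) x 0 i ^+ 2).

Definition partial (R : realType) (n : nat) (i : 'I_n) (f : 'rV[R]_n -> R)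
    (x : 'rV[R]_n) : R :=
  'D_(delta_mx 0 i) f x.

Definition gradient (R : realType) (n : nat) (f : 'rV[R]_n -> R)
    (x : 'rV[R]_n) : 'rV[R]_n :=
  \row_(i < n) partial i f x.

Definition laplacian (R : realType) (n : nat) (f : 'rV[R]_n -> R)
    (x : 'rV[R]_n) : R :=
  \sum_(i < n) partial i (partial i f) x.

(* derivable is required separately because 'D_v is a total operator. *)
Definition class_C1 (R : realType) (n : nat) (f : 'rV[R]_n -> R) : Prop :=
  continuous f /\
  forall i : 'I_n,
    (forall x, derivable f x (delta_mx 0 i)) /\ continuous (partial i f).

Definition class_C2 (R : realType) (n : nat) (f : 'rV[R]_n -> R) : Prop :=
  class_C1 f /\ forall i : 'I_n, class_C1 (partial i f).

Definition radially_symmetric (R : realType) (n : nat) (f : 'rV[R]_n -> R) :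
    Prop :=
  forall x y : 'rV[R]_n, enorm x = enorm y -> f x = f y.

Definition positive_radial_solution (R : realType) (n : nat)
    (a b p q s : R) (u v : 'rV[R]_n -> R) : Prop :=
  [/\ class_C2 u /\ class_C2 v,
      radially_symmetric u /\ radially_symmetric v,
      forall x, 0 < u x /\ 0 < v x,
      forall x, laplacian u x = enorm x `^ a * v x `^ p
    & forall x,
        laplacian v x = enorm x `^ b * v x `^ q * enorm (gradient u x) `^ s].

(* The filter of "|x| -> oo" on R^n. *)
Definition enorm_oo (R : realType) (n : nat) : set_system 'rV[R]_n :=
  filter_from [set: R] (fun M => [set x : 'rV[R]_n | M < enorm x]).

Global Instance enorm_oo_filter (R : realType) (n : nat) :
  Filter (@enorm_oo R n).
Proof.
apply: filter_from_filter; first by exists 0.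
move=> i j _ _; exists (Num.max i j) => // x /=.
by rewrite gt_max => /andP[].
Qed.

(* Main.v *)
(* On a ray the system becomes, for the fluxes w = r^(N-1) u' and
   z = r^(N-1) v', a cooperative first order system
   w' = al v^p, z' = be v^q w^s, v' = r^(1-N) z, u' = r^(1-N) w,
   with an explicit power solution (U, V, W, Z) tending to infinity.  If
   v <= k V near infinity, then comparing derivatives gives w <= k^(p+) W, then
   z <= k^(ps+q+) Z and v <= k^th V for any th > ps + q; choosing th < 1 and
   iterating brings the constant arbitrarily close to 1, and the same argument
   works from below.  The first constant k comes from the extremum of v / V on
   [1, r], which the same comparison bounds in terms of the data at r = 1. *)
Require Import Defs.
From HB Require Import structures.
From mathcomp Require Import all_boot all_order all_algebra.
From mathcomp Require Import all_classical all_reals all_analysis.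
From mathcomp Require Import ring lra.
Set Implicit Arguments.
Unset Strict Implicit.
Unset Printing Implicit Defensive.
Import Order.TTheory GRing.Theory Num.Theory.
Import numFieldNormedType.Exports.
Local Open Scope classical_set_scope.
Local Open Scope ring_scope.

(** * Inequalities in a variable direction *)

(* The upper (b = true) and lower (b = false) estimates on v / V and u / U have
   the same proof; ledir and ltdir let it be written once. *)
Definition ledir (R : realType) (b : bool) (x y : R) : bool :=
  if b then x <= y else y <= x.

Definition ltdir (R : realType) (b : bool) (x y : R) : bool :=
  if b then x < y else y < x.

Lemma ledir_trans (R : realType) b (y x z : R) :
  ledir b x y -> ledir b y z -> ledir b x z.
Proof. by case: b => /= xy yz; [apply: le_trans yz | apply: le_trans xy]. Qed.

Lemma ltdirW (R : realType) b (x y : R) : ltdir b x y -> ledir b x y.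
Proof. by case: b => /ltW. Qed.

Lemma ltdirNge (R : realType) b (x y : R) : ltdir b x y = ~~ ledir b y x.
Proof. by case: b; rewrite /= ltNge. Qed.

Lemma ledir_pM2l (R : realType) b (c x y : R) : 0 < c ->
  ledir b (c * x) (c * y) = ledir b x y.
Proof. by move=> c0; case: b; rewrite /= ler_pM2l. Qed.

Lemma ledirM (R : realType) b (x1 y1 x2 y2 : R) :
  0 < x1 -> 0 < y1 -> 0 < x2 -> 0 < y2 ->
  ledir b x1 y1 -> ledir b x2 y2 -> ledir b (x1 * x2) (y1 * y2).
Proof.
by move=> x10 y10 x20 y20; case: b => /= ? ?; apply: ler_pM => //; exact: ltW.
Qed.

Lemma ledir_powR (R : realType) b (e x y : R) : 0 <= e -> 0 < x -> 0 < y ->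
  ledir b x y -> ledir b (x `^ e) (y `^ e).
Proof.
by move=> e0 x0 y0; case: b => /= xy; apply: ge0_ler_powR;
  rewrite // nnegrE ltW.
Qed.

Lemma ltdir_powR (R : realType) b (k d e : R) : 0 < k -> ltdir b 1 k ->
  d < e -> ltdir b (k `^ d) (k `^ e).
Proof.
move=> k0; case: b => /= k1 de; rewrite /powR gt_eqF// ltr_expR.
  by rewrite ltr_pM2r// ln_gt0.
by rewrite ltr_nM2r// ln_lt0// k0.
Qed.

Lemma ledir_powRr (R : realType) b (k d e : R) : 0 < k -> ltdir b 1 k ->
  d <= e -> ledir b (k `^ d) (k `^ e).
Proof.
move=> k0 k1; rewrite le_eqVlt => /predU1P[->|de]; first by case: b {k1} => /=.
exact/ltdirW/ltdir_powR.
Qed.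

(** Serves to pick a first constant on the far side of 1 and of three thresholds coming from the
    data at one point. *)
Lemma ltdir_exists_ub (R : realType) b (x y z : R) :
  0 < x -> 0 < y -> 0 < z ->
  exists k, [/\ 0 < k, ltdir b 1 k, ledir b x k, ledir b y k
    & ledir b z k].
Proof.
case: b => /= x0 y0 z0.
  by exists (2 + x + y + z); split => /=; lra.
(* The entry 1/2 puts the minimum strictly below 1. *)
exists (Num.min (Num.min (Num.min x y) z) (2^-1)); split.
- by rewrite !lt_min x0 y0 z0 invr_gt0 ltr0n.
- rewrite gt_min; apply/orP; right; lra.
- by rewrite !ge_min lexx.
- by rewrite !ge_min lexx orbT.
- by rewrite !ge_min lexx orbT.
Qed.

Lemma ledir_div (R : realType) b (x y k : R) : 0 < y -> ledir b (x / y) k = ledir b x (k * y).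
Proof. by move=> y0; case: b => /=; rewrite (ler_pdivrMr, ler_pdivlMr). Qed.

(** * Comparison of functions through their derivatives *)

Lemma is_derive_increasing (R : realType) (f df : R -> R) (x y : R) :
  x <= y -> (forall t : R, x <= t <= y -> is_derive t 1 f (df t)) ->
  (forall t : R, x < t < y -> 0 <= df t) -> f x <= f y.
Proof.
rewrite le_eqVlt => /predU1P[->//|xy] fdf df0.
have [||c] := @MVT R f df x y xy.
- by move=> t; rewrite in_itv/= => /andP[? ?]; apply: fdf; rewrite !ltW.
- apply: derivable_within_continuous => t; rewrite in_itv/= => tab.
  exact: @ex_derive _ _ _ _ _ _ _ (fdf t tab).
rewrite in_itv/= => cxy; rewrite -subr_ge0 => ->.
by rewrite mulr_ge0 ?df0// subr_ge0 ltW.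
Qed.

Lemma derive_ledir_compare (R : realType) b (f df g dg : R -> R) (c x y : R) :
  x <= y ->
  (forall t : R, x <= t <= y -> is_derive t 1 f (df t)) ->
  (forall t : R, x <= t <= y -> is_derive t 1 g (dg t)) ->
  (forall t : R, x < t < y -> ledir b (df t) (c * dg t)) ->
  ledir b (f x) (c * g x) -> ledir b (f y) (c * g y).
Proof.
move=> xy Hf Hg; case: b => /= H H0.
- have : (c * g x - f x) <= (c * g y - f y).
    apply: (@is_derive_increasing _ (fun t => c * g t - f t)
      (fun t => c * dg t - df t)) => // t txy.
      have ? := Hf t txy; have ? := Hg t txy; exact: is_deriveB.
    by rewrite subr_ge0 H.
  lra.
- have : (f x - c * g x) <= (f y - c * g y).
    apply: (@is_derive_increasing _ (fun t => f t - c * g t)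
      (fun t => df t - c * dg t)) => // t txy.
      have ? := Hf t txy; have ? := Hg t txy; exact: is_deriveB.
    by rewrite subr_ge0 H.
  lra.
Qed.

(** Integrating the inequality of derivatives leaves an additive constant. Since [g] tends to
    infinity, the slack [(c' - c) * g] eventually absorbs it. *)
Lemma derive_ledir_near (R : realType) b (f df g dg : R -> R) (c c' : R) :
  ltdir b c c' ->
  (forall t : R, 0 < t -> is_derive t 1 f (df t)) ->
  (forall t : R, 0 < t -> is_derive t 1 g (dg t)) ->
  g x @[x --> +oo] --> +oo ->
  (\forall x \near +oo, ledir b (df x) (c * dg x)) ->
  \forall x \near +oo, ledir b (f x) (c' * g x).
Proof.
move=> cc' Hf Hg goo [M [Mr HM]].
(* The maximum with 1 keeps the starting point in the half-line where the derivatives are known. *)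
set r0 := Num.max M 1.
have r00 : 0 < r0 by rewrite lt_max ltr01 orbT.
pose C := (f r0 - c * g r0).
have H r : r0 <= r -> ledir b (f r) (C + c * g r).
  move=> r0r.
  have -> : C + c * g r = 1 * (C + c * g r) by rewrite mul1r.
  apply: (@derive_ledir_compare _ b f df (fun r => C + c * g r)
    (fun r => 0 + c * dg r) 1 r0 r r0r) 
    => [t /andP[t0 _]|t /andP[t0 _]|t /andP[t0 _]|].
  - exact/Hf/(lt_le_trans r00).
  - have ? := Hg t (lt_le_trans r00 t0); exact: is_deriveD.
  - rewrite add0r mul1r; apply: HM; apply: le_lt_trans t0.
    by rewrite le_max lexx.
  - rewrite mul1r /C subrK; by case: (b) => /=.
have c'c : c' - c != 0.
  by rewrite subr_eq0; move: cc'; case: (b) => /= h; [rewrite gt_eqF|rewrite lt_eqF].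
near=> r.
have r0r : r0 <= r by near: r; exact: nbhs_pinfty_ge (num_real _).
have gr : C / (c' - c) <= g r by near: r; move: goo => /cvgryPge; exact.
apply: (@ledir_trans _ _ (C + c * g r)); first exact: H.
(* In this form the lower bound on [g r], multiplied by [c' - c] of either sign, gives the claim in
   both directions. *)
have CE : C = (C / (c' - c)) * (c' - c) by rewrite divfK.
move: cc'; rewrite [in X in _ -> X]CE; case: (b) => /= cc'; nra.
Unshelve. all: by end_near. Qed.

Lemma cvg_ratio_ledir (R : realType) (f g : R -> R) : (\forall r \near +oo, 0 < g r) ->
  (forall b (c : R), 0 < c -> ltdir b 1 c ->
    \forall r \near +oo, ledir b (f r) (c * g r)) ->
  f r / g r @[r --> +oo] --> (1 : R).
Proof.
move=> g0 H; apply/cvgrPdist_le => e e0.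
have H1 := H true (1 + e) ltac:(lra) ltac:(rewrite /=; lra).
(* The maximum with 1/2 keeps the lower constant positive even for [e >= 1]. *)
have [m0 m1 me] : [/\ 0 < Num.max (1 - e) 2^-1, Num.max (1 - e) 2^-1 < 1
    & 1 - e <= Num.max (1 - e) 2^-1].
  by rewrite lt_max gt_max le_max lexx; split=> //;
    [apply/orP; right | apply/andP; split]; lra.
have H2 := H false _ m0 m1.
near=> r.
have gr : 0 < g r by near: r.
have : ledir true (f r) ((1 + e) * g r) by near: r.
have : ledir false (f r) (Num.max (1 - e) 2^-1 * g r) by near: r.
rewrite /= -(ler_pdivlMr _ _ gr) -(ler_pdivrMr _ _ gr) ler_norml => *; apply/andP; split; lra.
Unshelve. all: by end_near. Qed.

(** * Comparison of two solutions of the first order system *)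

Section sublinear_system.
Context (R : realType) (p q s : R) (al be ga : R -> R).
Hypotheses (p0 : 0 < p) (q0 : 0 < q) (s0 : 0 < s) (hpsq : p * s + q < 1).
Hypotheses (al0 : forall r : R, 0 < r -> 0 < al r)
  (be0 : forall r : R, 0 < r -> 0 < be r) (ga0 : forall r : R, 0 < r -> 0 < ga r).

(* The radial system in first order form, for the fluxes w = r^(N-1) u' and
   z = r^(N-1) v'. *)
Record system_solution (u v w z : R -> R) : Prop := SystemSolution {
  sol_v_gt0 : forall r : R, 0 < r -> 0 < v r ;
  sol_w_gt0 : forall r : R, 0 < r -> 0 < w r ;
  sol_z_gt0 : forall r : R, 0 < r -> 0 < z r ;
  sol_derive_w : forall r : R, 0 < r -> is_derive r 1 w (al r * v r `^ p) ;
  sol_derive_z : forall r : R, 0 < r ->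
    is_derive r 1 z (be r * (v r `^ q * w r `^ s)) ;
  sol_derive_v : forall r : R, 0 < r -> is_derive r 1 v (ga r * z r) ;
  sol_derive_u : forall r : R, 0 < r -> is_derive r 1 u (ga r * w r) }.

Context (u v w z U V W Z : R -> R).
Hypotheses (sol : system_solution u v w z) (SOL : system_solution U V W Z).

Let th := p * s + q.

Let th0 : 0 < th. Proof. by rewrite addr_gt0// mulr_gt0. Qed.

Lemma rhs_w_ledir b (k r : R) : 0 < k -> 0 < r -> ledir b (v r) (k * V r) ->
  ledir b (al r * v r `^ p) (k `^ p * (al r * V r `^ p)).
Proof.
move=> k0 r0 H; have v0 := sol_v_gt0 sol r0.
have V0 := sol_v_gt0 SOL r0.
rewrite mulrCA ledir_pM2l ?al0// -powRM ?ltW//.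
by apply: ledir_powR => //; [exact: ltW | exact: mulr_gt0].
Qed.

(** By homogeneity: [v] contributes [k] to the power [q], and [w] contributes [k] to the power
    [d * s]. *)
Lemma rhs_z_ledir b (k d r : R) : 0 < k -> 0 < r -> ledir b (v r) (k * V r) ->
  ledir b (w r) (k `^ d * W r) ->
  ledir b (be r * (v r `^ q * w r `^ s))
    (k `^ (d * s + q) * (be r * (V r `^ q * W r `^ s))).
Proof.
move=> k0 r0 H H1; have v0 := sol_v_gt0 sol r0.
have V0 := sol_v_gt0 SOL r0.
have w0 := sol_w_gt0 sol r0.
have W0 := sol_w_gt0 SOL r0.
have kd0 : 0 < k `^ d by rewrite powR_gt0.
rewrite [X in ledir _ _ X]mulrCA ledir_pM2l ?be0// powRD ?(gt_eqF k0) ?implybT//.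
have -> : k `^ (d * s) * k `^ q * (V r `^ q * W r `^ s)
    = (k * V r) `^ q * (k `^ d * W r) `^ s.
  by rewrite !powRM ?ltW// -powRrM; ring.
apply: ledirM; rewrite ?powR_gt0 ?mulr_gt0//.
  by apply: ledir_powR; rewrite ?mulr_gt0// ltW.
by apply: ledir_powR; rewrite ?mulr_gt0// ltW.
Qed.

(** One turn of the cycle from v to w to z and back to v. The inequalities assumed at [r0] leave no
    integration constant, so the exponents p and [th] are attained without loss. *)
Lemma segment_improve b (k r0 r : R) : 0 < k -> 0 < r0 ->
  (forall t, r0 <= t <= r -> ledir b (v t) (k * V t)) ->
  ledir b (w r0) (k `^ p * W r0) ->
  ledir b (z r0) (k `^ th * Z r0) ->
  ledir b (v r0) (k `^ th * V r0) ->
  forall t, r0 <= t <= r -> ledir b (v t) (k `^ th * V t).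
Proof.
move=> k0 r00 Hv Hw0 Hz0 Hv0.
have pos x t : r0 <= t <= x -> 0 < t by case/andP => /(lt_le_trans r00).
have poso x t : r0 < t < x -> 0 < t by case/andP => /(lt_trans r00).
have Hw t : r0 <= t <= r -> ledir b (w t) (k `^ p * W t).
  case/andP => r0t tr; apply: derive_ledir_compare Hw0 => //.
  - by move=> x /pos x0; exact: sol_derive_w sol _ x0.
  - by move=> x /pos x0; exact: sol_derive_w SOL _ x0.
  - move=> x xt; apply: rhs_w_ledir => //; first exact: poso xt.
    by apply: Hv; move: xt tr => /andP[]; lra.
have Hz t : r0 <= t <= r -> ledir b (z t) (k `^ th * Z t).
  case/andP => r0t tr; apply: derive_ledir_compare Hz0 => //.
  - by move=> x /pos x0; exact: sol_derive_z sol _ x0.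
  - by move=> x /pos x0; exact: sol_derive_z SOL _ x0.
  - move=> x xt; have xr : r0 <= x <= r by move: xt tr => /andP[]; lra.
    by apply: rhs_z_ledir; rewrite ?(poso _ _ xt) ?Hv ?Hw.
move=> t /andP[r0t tr]; apply: derive_ledir_compare Hv0 => //.
- by move=> x /pos x0; exact: sol_derive_v sol _ x0.
- by move=> x /pos x0; exact: sol_derive_v SOL _ x0.
- move=> x xt; rewrite mulrCA ledir_pM2l ?ga0 ?(poso _ _ xt)//.
  by apply: Hz; move: xt tr => /andP[]; lra.
Qed.

(** * A bound for v / V on the half-line from 1 *)

Lemma ratio_extremum b (r : R) : 1 <= r -> exists2 t, 1 <= t <= r &
  forall x, 1 <= x <= r -> ledir b (v x / V x) (v t / V t).
Proof.
move=> r1; have cont : {within `[1, r], continuous (fun x => v x / V x)}.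
  apply: derivable_within_continuous => x; rewrite in_itv/= => /andP[x1 _].
  have x0 : 0 < x by lra.
  have ? := sol_derive_v sol x0.
  have ? := sol_derive_v SOL x0.
  apply: derivableM; first exact: ex_derive.
  apply: derivableV; last exact: ex_derive.
  by rewrite gt_eqF// (sol_v_gt0 SOL).
case: b => /=; [have [t] := EVT_max r1 cont|have [t] := EVT_min r1 cont];
  rewrite in_itv/= => tr H; exists t => // x xr; apply: H; by rewrite in_itv.
Qed.

(* If the extremum k of v / V over [1, r] lies beyond all the bounds coming
   from the data at 1, segment_improve replaces k by k^th, which is closer to 1
   since th < 1. *)
Lemma a_priori_bound b : exists k, [/\ 0 < k, ltdir b 1 k &
  forall r, 1 <= r -> ledir b (v r) (k * V r)].
Proof.
have pos (f g : R) e : 0 < f -> 0 < g -> 0 < (f / g) `^ e^-1.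
  by move=> f0 g0; rewrite powR_gt0// divr_gt0.
have lt01 := @ltr01 R.
have [v0 V0] := (sol_v_gt0 sol lt01, sol_v_gt0 SOL lt01).
have [w0 W0] := (sol_w_gt0 sol lt01, sol_w_gt0 SOL lt01).
have [z0 Z0] := (sol_z_gt0 sol lt01, sol_z_gt0 SOL lt01).
(* These roots are the thresholds beyond which a constant satisfies the three inequalities at 1 that
   [segment_improve] requires. *)
have [k [k0 k1 kw kz kv]] := ltdir_exists_ub b
  (pos _ _ p w0 W0) (pos _ _ th z0 Z0) (pos _ _ th v0 V0).
exists k; split => // r r1.
have [t tr Ht] := ratio_extremum b r1.
have t0 : 0 < t by case/andP: tr; lra.
have vt := sol_v_gt0 sol t0; have Vt := sol_v_gt0 SOL t0.
have r0 : 0 < r by lra.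
have vr := sol_v_gt0 sol r0; have Vr := sol_v_gt0 SOL r0.
set m := v t / V t in Ht.
have m0 : 0 < m by rewrite divr_gt0.
have [mk|/negPf] := boolP (ledir b m k).
  by rewrite -ledir_div//; apply: ledir_trans mk; apply: Ht; rewrite r1 lexx.
move/negbT; rewrite -ltdirNge => km.
have m1 : ltdir b 1 m.
  move: k1 km; case: (b) => /=; first exact: lt_trans.
  by move=> k1 km; exact: lt_trans km k1.
have init f g e : 0 < e -> 0 < f -> 0 < g -> ledir b ((f / g) `^ e^-1) k ->
    ledir b f (m `^ e * g).
  move=> e0 f0 g0 H; rewrite -ledir_div//.
  have -> : f / g = ((f / g) `^ e^-1) `^ e.
    by rewrite -powRrM mulVf ?gt_eqF// powRr1// ltW// divr_gt0.
  apply: ledir_powR => //; rewrite ?pos// ?ltW//.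
  exact: ledir_trans H (ltdirW km).
have : ledir b (v t) (m `^ th * V t).
  apply: (segment_improve m0 lt01 _ _ _ _ tr).
  - move=> x xr; rewrite -ledir_div ?Ht// (sol_v_gt0 SOL)//.
    by case/andP: xr; lra.
  - exact: init.
  - exact: init.
  - exact: init.
(* At the extremal point this compares [m] with its own power [th]; as [m] lies beyond 1 in
   direction [b] and [th < 1], it is a contradiction. *)
rewrite -ledir_div// -/m -[X in ledir _ X _](@powRr1 _ m) ?ltW//.
by have := ltdir_powR m0 m1 hpsq; rewrite -/th ltdirNge => /negPf ->.
Qed.

(** * Sharpening the constants near infinity *)

Hypotheses (Uoo : U x @[x --> +oo] --> +oo) (Voo : V x @[x --> +oo] --> +oo)
  (Woo : W x @[x --> +oo] --> +oo) (Zoo : Z x @[x --> +oo] --> +oo).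

Lemma w_ledir_near b (k d : R) : 0 < k -> ltdir b 1 k -> p < d ->
  (\forall r \near +oo, ledir b (v r) (k * V r)) ->
  \forall r \near +oo, ledir b (w r) (k `^ d * W r).
Proof.
move=> k0 k1 pd H; apply: derive_ledir_near Woo _.
- exact: ltdir_powR pd.
- exact: sol_derive_w sol.
- exact: sol_derive_w SOL.
near=> r; apply: rhs_w_ledir => //; by near: r.
Unshelve. all: by end_near. Qed.

Lemma u_ledir_near b (k d : R) : 0 < k -> ltdir b 1 k -> p < d ->
  (\forall r \near +oo, ledir b (v r) (k * V r)) ->
  \forall r \near +oo, ledir b (u r) (k `^ d * U r).
Proof.
(* Two integrations, for w and then u, each use half of the gap between p and [d]. *)
move=> k0 k1 pd H; have [pe ed] := midf_lt pd.
have Hw := w_ledir_near k0 k1 pe H.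
apply: derive_ledir_near Uoo _.
- exact: ltdir_powR ed.
- exact: sol_derive_u sol.
- exact: sol_derive_u SOL.
near=> r.
have r0 : 0 < r by near: r; exact: nbhs_pinfty_gt (num_real _).
by rewrite mulrCA ledir_pM2l ?ga0//; near: r.
Unshelve. all: by end_near. Qed.

Lemma v_ledir_near b (k d : R) : 0 < k -> ltdir b 1 k -> th < d ->
  (\forall r \near +oo, ledir b (v r) (k * V r)) ->
  \forall r \near +oo, ledir b (v r) (k `^ d * V r).
Proof.
(* Each of the three integrations costs some slack. The exponent [p + e / s] for w gives [th + e] on
   the right-hand side for z; then z gets [th + 2 * e] and v gets [th + 3 * e = d]. *)
move=> k0 k1 thd H; pose e := (d - th) / 3.
have e0 : 0 < e by rewrite divr_gt0 ?subr_gt0.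
have dE : d = th + 3 * e by rewrite /e; field.
have Hw : \forall r \near +oo, ledir b (w r) (k `^ (p + e / s) * W r).
  by apply: w_ledir_near => //; rewrite ltrDl divr_gt0.
have Hz : \forall r \near +oo, ledir b (z r) (k `^ (th + 2 * e) * Z r).
  apply: derive_ledir_near Zoo _.
  - apply: (@ltdir_powR _ _ _ ((p + e / s) * s + q)) => //.
    rewrite mulrDl divfK ?gt_eqF// /th; lra.
  - exact: sol_derive_z sol.
  - exact: sol_derive_z SOL.
  near=> r; apply: rhs_z_ledir => //; by near: r.
apply: derive_ledir_near Voo _.
- apply: (@ltdir_powR _ _ _ (th + 2 * e)) => //; rewrite dE; lra.
- exact: sol_derive_v sol.
- exact: sol_derive_v SOL.
near=> r.
have r0 : 0 < r by near: r; exact: nbhs_pinfty_gt (num_real _).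
by rewrite mulrCA ledir_pM2l ?ga0//; near: r.
Unshelve. all: by end_near. Qed.

(** Iterating [v_ledir_near] with a fixed [d] strictly between [th] and 1 yields the constants [k]
    to the power [d ^+ n], which tend to 1 and so pass [c] after finitely many steps. *)
Lemma v_ledir_sharp b (c : R) : 0 < c -> ltdir b 1 c ->
  \forall r \near +oo, ledir b (v r) (c * V r).
Proof.
move=> c0 c1; have [k [k0 k1 Hk]] := a_priori_bound b.
have [thd d1] := midf_lt hpsq; set d := (_ / 2) in thd d1.
have d0 : 0 < d by exact: lt_trans thd.
have dn0 n : 0 < d ^+ n by exact: exprn_gt0.
have kn0 n : 0 < k `^ (d ^+ n) by exact: powR_gt0.
have kn1 n : ltdir b 1 (k `^ (d ^+ n)).
  by rewrite -[X in ltdir _ X](powRr0 k); exact: ltdir_powR.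
have Hn n : \forall r \near +oo, ledir b (v r) (k `^ (d ^+ n) * V r).
  elim: n => [|n IH].
    rewrite expr0 powRr1 ?ltW//; near=> r; apply: Hk.
    by near: r; exact: nbhs_pinfty_ge (num_real _).
  by rewrite exprSr powRrM; exact: v_ledir_near.
(* This quotient is the exponent that turns [k] into [c]; it is positive because [c] and [k] lie on
   the same side of 1. *)
have e0 : 0 < ln c / ln k.
  move: c1 k1; case: (b) => /= c1 k1.
    by rewrite divr_gt0// ln_gt0.
  by rewrite -mulrNN -invrN divr_gt0// oppr_gt0 ln_lt0 ?c0 ?k0.
have lnk0 : ln k != 0.
  move: k1; case: (b) => /= k1; first by rewrite gt_eqF// ln_gt0.
  by rewrite lt_eqF// ln_lt0// k0.
have [n dn] : exists n, d ^+ n <= ln c / ln k.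
  have /cvgrPdist_le/(_ _ e0)[n _ /(_ n)/=] := @cvg_expr R d
    ltac:(by rewrite ger0_norm// ltW).
  rewrite leqnn sub0r normrN (ger0_norm (ltW (dn0 n))) => /(_ isT); by exists n.
have cE : c = k `^ (ln c / ln k).
  by apply: ln_inj; rewrite ?posrE ?powR_gt0// ln_powR divfK.
near=> r.
have r0 : 0 < r by near: r; exact: nbhs_pinfty_gt (num_real _).
apply: (@ledir_trans _ _ (k `^ (d ^+ n) * V r)); first by near: r.
rewrite ![_ * V r]mulrC ledir_pM2l ?(sol_v_gt0 SOL)// cE.
exact: ledir_powRr.
Unshelve. all: by end_near. Qed.

Lemma u_ledir_sharp b (c : R) : 0 < c -> ltdir b 1 c ->
  \forall r \near +oo, ledir b (u r) (c * U r).
Proof.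
move=> c0 c1; have p1 : 0 < p + 1 by rewrite addr_gt0.
(* This root is chosen so that the exponent [p + 1], which exceeds p, returns exactly [c]. *)
have k0 : 0 < c `^ (p + 1)^-1 by exact: powR_gt0.
have k1 : ltdir b 1 (c `^ (p + 1)^-1).
  by rewrite -[X in ltdir _ X](powRr0 c); apply: ltdir_powR; rewrite ?invr_gt0.
have /((u_ledir_near (d := p + 1)) k0 k1) := v_ledir_sharp k0 k1.
by rewrite -powRrM mulVf ?gt_eqF// powRr1 ?ltW//; apply; rewrite ltrDl.
Qed.

Theorem system_ratio_cvg :
  u r / U r @[r --> +oo] --> (1 : R) /\ v r / V r @[r --> +oo] --> (1 : R).
Proof.
split; apply: cvg_ratio_ledir.
- by move/cvgryPgt : Uoo; apply.
- exact: u_ledir_sharp.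
- by move/cvgryPgt : Voo; apply.
- exact: v_ledir_sharp.
Qed.

End sublinear_system.

(** * The explicit power solution *)

Lemma is_derive_scale_powR (R : realType) (c e r : R) : 0 < r ->
  is_derive r 1 (fun t => c * t `^ e) (c * e * r `^ (e - 1)).
Proof.
by move=> r0; rewrite -mulrA; exact: (is_deriveZ c (is_derive1_powR e r0)).
Qed.

Lemma cvg_scale_powR_pinfty (R : realType) (c e : R) : 0 < c -> 0 < e ->
  c * r `^ e @[r --> +oo] --> +oo.
Proof.
move=> c0 e0; apply/cvgryPge => M.
have M0 : 0 < Num.max (M / c) 1 by rewrite lt_max ltr01 orbT.
near=> r.
rewrite mulrC -ler_pdivrMr//.
apply: (@le_trans _ _ (Num.max (M / c) 1)); first by rewrite le_max lexx.
(* The bound is written as the e-th power of its e-th root, so that it is enough for [r] to exceed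
   that root. *)
rewrite -[leLHS](@powRr1 _ _ (ltW M0)) -[X in _ `^ X](mulVf (lt0r_neq0 e0)).
have Mr : Num.max (M / c) 1 `^ e^-1 <= r.
  by near: r; exact: nbhs_pinfty_ge (num_real _).
rewrite powRrM; apply: ge0_ler_powR => //; first exact: ltW.
  by rewrite nnegrE powR_ge0.
by rewrite nnegrE (le_trans _ Mr)// powR_ge0.
Unshelve. all: by end_near. Qed.

(** The relations on A, B, K and D balance the powers of r in the four equations. The coefficients
    of u, w and z are forced by the equations for u, w and v, and the last relation, on [c],
    balances the equation for z. *)
Lemma power_system_solution (R : realType) (p q s a b m A B K D c : R) :
  0 < c -> 0 < A -> 0 < B -> 0 < K -> 0 < D ->
  A = 2 + b + s * (1 + a) + (p * s + q) * A ->
  B = m + 1 + a + p * A -> K = A - 1 + m -> D = 2 + a + p * A ->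
  A * B `^ s * K * c = c `^ (p * s + q) ->
  system_solution p q s (fun r => r `^ (m + a)) (fun r => r `^ (m + b - s * m))
    (fun r => r `^ (- m))
    (fun r => c `^ p / (D * B) * r `^ D) (fun r => c * r `^ A)
    (fun r => c `^ p / B * r `^ B) (fun r => c * A * r `^ K).
Proof.
move=> c0 A0 B0 K0 D0 AE BE KE DE cE.
have pw (x y r : R) : 0 < r -> r `^ x * r `^ y = r `^ (x + y).
  by move=> r0; rewrite powRD// (gt_eqF r0) implybT.
have [cp0 An0 Bn0 Kn0 Dn0] : [/\ 0 < c `^ p, A != 0, B != 0, K != 0 & D != 0].
  by rewrite powR_gt0 ?gt_eqF.
split=> r r0.
- by rewrite mulr_gt0// powR_gt0.
- by rewrite !mulr_gt0// ?invr_gt0// powR_gt0.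
- by rewrite !mulr_gt0// powR_gt0.
- apply: is_derive_eq; first exact: is_derive_scale_powR.
  rewrite divfK// powRM ?powR_ge0 ?ltW// mulrCA -powRrM pw//.
  by congr (_ * _ `^ _); rewrite BE; ring.
- apply: is_derive_eq; first exact: is_derive_scale_powR.
  have cpB : 0 <= c `^ p / B by rewrite divr_ge0 ?ltW.
  rewrite !powRM ?powR_ge0 ?invr_ge0 ?(ltW c0) ?(ltW B0)// -!powRrM.
  have -> : r `^ (m + b - s * m) *
      (c `^ q * r `^ (A * q) * (c `^ (p * s) * B^-1 `^ s * r `^ (B * s)))
    = (c `^ (p * s) * c `^ q) * (B^-1 `^ s)
      * (r `^ (m + b - s * m) * r `^ (A * q) * r `^ (B * s)) by ring.
  rewrite !pw// -cE.
  have -> : B^-1 `^ s = (B `^ s)^-1 by rewrite -powR_inv1 ?ltW// -powRrM mulN1r powRN.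
  congr (_ * _ `^ _).
    by field; rewrite gt_eqF// powR_gt0.
  by rewrite KE BE {1}AE; ring.
- apply: is_derive_eq; first exact: is_derive_scale_powR.
  rewrite mulrCA pw//; congr (_ * _ `^ _); rewrite KE; ring.
- apply: is_derive_eq; first exact: is_derive_scale_powR.
  rewrite mulrCA pw//; congr (_ * _ `^ _); last by rewrite DE BE; ring.
  by field; rewrite Bn0.
Qed.

(** * Derivatives of radial functions along a coordinate axis *)

Lemma is_derive_line (R : realType) (V W : normedModType R) (f : V -> W)
    (x e : V) (t : R) (d : W) :
  is_derive (x + t *: e) e f d <-> is_derive t 1 (fun t => f (x + t *: e)) d.
Proof.
have E : (fun h : R => h^-1 *: ((f \o shift (x + t *: e)) (h *: e)
      - f (x + t *: e)))
    = (fun h : R => h^-1 *: (((fun t => f (x + t *: e)) \o shift t) (h *: 1)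
      - f (x + t *: e))).
  apply/funext => h /=; rewrite [h *: 1]mulr1 scalerDl.
  by rewrite [x + (_ + _)]addrCA.
split=> -[H1 H2]; split; rewrite /derivable /derive ?E// -?E//.
Qed.

Section radial.
Context (R : realType) (n : nat) (i0 : 'I_n) (f : 'rV[R]_n -> R).
Let e i : 'rV[R]_n := delta_mx 0 i.
Hypotheses (frad : radially_symmetric f) (fC2 : class_C2 f).

Lemma enorm_axis (r : R) : 0 <= r -> enorm (r *: e i0) = r.
Proof.
move=> r0; rewrite /enorm (bigD1 i0)//= big1 ?addr0.
  by rewrite !mxE !eqxx mulr1 sqrtr_sqr ger0_norm.
by move=> i /negPf ii0; rewrite !mxE ii0 andbF mulr0 expr0n.
Qed.

Lemma enorm_off_axis (r h : R) i : i != i0 ->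
  enorm (r *: e i0 + h *: e i) = Num.sqrt (r ^+ 2 + h ^+ 2).
Proof.
move=> ii0; rewrite /enorm (bigD1 i0)//= (bigD1 i)//= big1 ?addr0.
  rewrite !mxE !eqxx (negPf ii0) eq_sym (negPf ii0).
  by rewrite !andbF !mulr1 !mulr0 add0r addr0.
move=> j /andP[/negPf ji0 /negPf ji].
by rewrite !mxE ji0 ji !andbF !mulr0 addr0 expr0n.
Qed.

Let g r := f (r *: e i0).
Let g1 r := partial i0 f (r *: e i0).
Let g2 r := partial i0 (partial i0 f) (r *: e i0).

Let is_derive_axis (F : 'rV[R]_n -> R) i (t : R) :
  class_C1 F -> is_derive t 1 (fun t : R => F (t *: e i)) (partial i F (t *: e i)).
Proof.
move=> [_ /(_ i)[dF _]].
have /is_derive_line := @derivableP _ _ _ _ _ _ (dF (0 + t *: e i)).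
rewrite add0r; under eq_fun do rewrite add0r; exact.
Qed.

Lemma is_derive_profile (r : R) : is_derive r 1 g (g1 r).
Proof. by apply: is_derive_axis; case: fC2. Qed.

Lemma is_derive_profile1 (r : R) : is_derive r 1 g1 (g2 r).
Proof. by apply: is_derive_axis; case: fC2. Qed.

Let rho r (h : R) := Num.sqrt (r ^+ 2 + h ^+ 2).

Let rho_gt0 (r h : R) : 0 < r -> 0 < rho r h.
Proof. by move=> r0; rewrite sqrtr_gt0 ltr_pwDl ?sqr_ge0// exprn_gt0. Qed.

Let is_derive_rho (r h : R) : 0 < r -> is_derive h 1 (rho r) (h / rho r h).
Proof.
move=> r0.
have H : is_derive h 1 (fun h : R => r ^+ 2 + h ^+ 2) (0 + 2 * h).
  have /derivableP := @exprn_derivable R 2 h 1.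
  rewrite exp_derive expr1 [_ *: 1]mulr1 => H2; exact: is_deriveD.
have P : 0 < r ^+ 2 + h ^+ 2 by rewrite ltr_pwDl ?sqr_ge0// exprn_gt0.
apply: (is_derive_eq 
  (@is_derive1_comp _ Num.sqrt (fun h => r ^+ 2 + h ^+ 2) _ _ _
    (is_derive1_sqrt P) H)).
have := rho_gt0 h r0; rewrite /rho => /lt0r_neq0; move: (Num.sqrt _) => y y0.
by field.
Qed.

(** On the line leaving the axis at [r] in direction [i], radial symmetry makes [f] the profile
    composed with [rho r], and the chain rule applies. *)
Lemma partial_off_axis (r h : R) i : 0 < r -> i != i0 ->
  partial i f (r *: e i0 + h *: e i) = h * (g1 (rho r h) / rho r h).
Proof.
move=> r0 ii0.
have := is_derive1_comp (is_derive_profile (rho r h)) (is_derive_rho h r0).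
have -> : g \o rho r = fun h => f (r *: e i0 + h *: e i).
  apply/funext => x; apply: frad; rewrite enorm_off_axis// enorm_axis//.
  exact: sqrtr_ge0.
move=> /is_derive_line/@derive_val H; apply: etrans H _.
by rewrite mulrCA.
Qed.

Lemma partial2_off_axis (r : R) i : 0 < r -> i != i0 ->
  partial i (partial i f) (r *: e i0) = g1 r / r.
Proof.
move=> r0 ii0.
have rho0 : rho r 0 = r by rewrite /rho expr0n addr0 sqrtr_sqr ger0_norm ?ltW.
have : is_derive (0 : R) 1 (fun h => partial i f (r *: e i0 + h *: e i)) (g1 r / r).
  under eq_fun do rewrite partial_off_axis//.
  have H1 := is_derive1_comp (is_derive_profile1 (rho r 0)) (is_derive_rho 0 r0).
  have H2 := is_derive_rho 0 r0.
  have H3 : rho r 0 != 0 by rewrite rho0 gt_eqF.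
  have H4 := is_deriveM H1 (is_deriveV H3 H2).
  (* At [h = 0] the factor [h] kills the derivative of the quotient, and only the quotient itself
     remains. *)
  apply: (is_derive_eq (is_deriveM (is_derive_id _ _) H4)).
  rewrite scale0r add0r; apply: etrans (mulr1 _) _.
  by rewrite fctE /= rho0.
by move=> /is_derive_line/@derive_val; rewrite scale0r addr0.
Qed.

Lemma laplacian_axis (r : R) : 0 < r ->
  laplacian f (r *: e i0) = g2 r + (n%:R - 1) * (g1 r / r).
Proof.
move=> r0; rewrite /laplacian (bigD1 i0)//=; congr (_ + _).
rewrite (eq_bigr (fun=> g1 r / r)); last by move=> i; exact: partial2_off_axis.
rewrite sumr_const cardC1 card_ord -[LHS]mulr_natl; congr (_ * _).
(* The index [i0] excludes dimension 0, so the natural number predecessor agrees with subtraction of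
   1 in the field. *)
by case: (n) i0 => [[]//|k] _; rewrite -natr1 addrK.
Qed.

Lemma enorm_gradient_axis (r : R) : 0 < r ->
  enorm (gradient f (r *: e i0)) = `|g1 r|.
Proof.
move=> r0; rewrite /enorm (bigD1 i0)//= big1 ?addr0 ?mxE ?sqrtr_sqr//.
move=> i ii0; rewrite mxE.
have := partial_off_axis 0 r0 ii0.
by rewrite scale0r addr0 => ->; rewrite mul0r expr0n.
Qed.

End radial.

(** * Positivity of the fluxes and reduction to the first order system *)

Lemma pos_of_derive_pos (R : realType) (f df : R -> R) :
  (forall r : R, 0 < r -> is_derive r 1 f (df r)) ->
  (forall r : R, 0 < r -> 0 < df r) ->
  f r @[r --> 0^'+] --> 0 -> forall r : R, 0 < r -> 0 < f r.
Proof.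
move=> Hf df0 f0 r r0.
have r20 : 0 < r / 2 by rewrite divr_gt0.
(* Monotonicity and the limit at 0 give only a weak inequality; the mean value theorem on
   [[r / 2, r]] then makes it strict. *)
have fr2 : 0 <= f (r / 2).
  rewrite -(cvg_lim _ f0)//; apply: limr_le; first by apply/cvg_ex; exists 0.
  near=> t.
  have t0 : 0 < t by near: t; exact: nbhs_right_gt.
  apply: (@is_derive_increasing _ f df).
  - by near: t; exact: nbhs_right_le.
  - by move=> x /andP[tx _]; apply/Hf/(lt_le_trans t0).
  - by move=> x /andP[tx _]; apply/ltW/df0/(lt_trans t0).
apply: (le_lt_trans fr2).
have r2r : r / 2 < r by rewrite ltr_pdivrMr// ltr_pMr ?ltr1n.
have [||c cr] := @MVT R f df _ _ r2r.
- by move=> x; rewrite in_itv/= => /andP[rx _]; apply/Hf/(lt_trans r20).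
- apply: derivable_within_continuous => x; rewrite in_itv/= => /andP[rx _].
  exact: @ex_derive _ _ _ _ _ _ _ (Hf x (lt_le_trans r20 rx)).
rewrite -subr_gt0 => ->; rewrite mulr_gt0 ?subr_gt0// df0//.
by move: cr; rewrite in_itv/= => /andP[rc _]; exact: lt_trans rc.
Unshelve. all: by end_near. Qed.

Lemma flux_gt0 (R : realType) (m : R) (h dh : R -> R) : 0 < m ->
  (forall r : R, is_derive r 1 h (dh r)) ->
  (forall r : R, 0 < r -> 0 < dh r + m * (h r / r)) ->
  (forall r : R, 0 < r -> is_derive r 1 (fun r => r `^ m * h r)
    (r `^ m * (dh r + m * (h r / r))))
  /\ forall r : R, 0 < r -> 0 < r `^ m * h r.
Proof.
move=> m0 Hh pos.
have D (r : R) : 0 < r -> is_derive r 1 (fun r => r `^ m * h r)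
    (r `^ m * (dh r + m * (h r / r))).
  move=> r0; apply: (is_derive_eq (is_deriveM (is_derive1_powR m r0) (Hh r))).
  rewrite powRB ?(gt_eqF r0) ?implybT// powRr1 ?ltW//= /GRing.scale/=.
  by field; rewrite gt_eqF.
split=> // ; apply: pos_of_derive_pos D _ _.
  by move=> r r0; rewrite mulr_gt0 ?powR_gt0 ?pos.
(* The flux vanishes at the origin because [m > 0] and [h], differentiable at 0, is continuous
   there. *)
rewrite -[X in _ --> X](mul0r (h 0)); apply: cvgM; first exact: powR_cvg0.
apply: cvg_at_right_filter.
apply: differentiable_continuous; apply/derivable1_diffP.
exact: @ex_derive _ _ _ _ _ _ _ (Hh 0).
Qed.

(** The factor r^m turns the polar form of the Laplacian into an exact derivative. Writing the
    gradient of u as r^(-m) w brings the power [- s * m] into the coefficient of the z equation. *)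
Lemma radial_system_solution (R : realType) (n : nat) (i0 : 'I_n)
    (a b p q s : R) (u v : 'rV[R]_n -> R) (m : R := n%:R - 1) :
  (2 <= n)%N -> positive_radial_solution a b p q s u v ->
  system_solution p q s (fun r => r `^ (m + a)) (fun r => r `^ (m + b - s * m))
    (fun r => r `^ (- m))
    (fun r => u (r *: delta_mx 0 i0)) (fun r => v (r *: delta_mx 0 i0))
    (fun r => r `^ m * partial i0 u (r *: delta_mx 0 i0))
    (fun r => r `^ m * partial i0 v (r *: delta_mx 0 i0)).
Proof.
move=> n2 [[uC2 vC2] [urad vrad] uv0 eqU eqV].
have m0 : 0 < m by rewrite subr_gt0 ltr1n.
have pw (x y r : R) : 0 < r -> r `^ x * r `^ y = r `^ (x + y).
  by move=> r0; rewrite powRD// (gt_eqF r0) implybT.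
have lapU (r : R) (r0 : 0 < r) := laplacian_axis i0 urad uC2 r0.
have lapV (r : R) (r0 : 0 < r) := laplacian_axis i0 vrad vC2 r0.
have v0 (r : R) : 0 < v (r *: delta_mx 0 i0) by have [] := uv0 (r *: delta_mx 0 i0).
(* The function u comes first: its positive flux makes the gradient nonzero, hence the right-hand
   side for v positive. *)
have [|Dw w0] := flux_gt0 m0 (is_derive_profile1 i0 uC2).
  by move=> r r0; rewrite -lapU// eqU enorm_axis ?ltW// mulr_gt0// powR_gt0.
have du0 (r : R) : 0 < r -> 0 < partial i0 u (r *: delta_mx 0 i0).
  by move=> r0; have := w0 r r0; rewrite pmulr_rgt0// powR_gt0.
have [|Dz z0] := flux_gt0 m0 (is_derive_profile1 i0 vC2).
  move=> r r0; rewrite -lapV// eqV enorm_axis ?ltW// !mulr_gt0 ?powR_gt0//.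
  by rewrite (enorm_gradient_axis i0 urad uC2 r0) normr_gt0 gt_eqF ?du0.
split=> // r r0.
- apply: (is_derive_eq (Dw r r0)).
  by rewrite -lapU// eqU enorm_axis ?ltW// mulrA pw.
- apply: (is_derive_eq (Dz r r0)).
  rewrite -lapV// eqV enorm_axis ?ltW// (enorm_gradient_axis i0 urad uC2 r0).
  rewrite gtr0_norm ?du0// powRM ?powR_ge0 ?(ltW (du0 r r0))// -powRrM.
  set du := partial _ _ _; set vr := v _.
  have -> : r `^ (m + b - s * m) * (vr `^ q * (r `^ (m * s) * du `^ s))
    = (r `^ (m + b - s * m) * r `^ (m * s)) * (vr `^ q * du `^ s) by ring.
  rewrite pw// (_ : m + b - s * m + m * s = m + b); last by ring.
  by rewrite -pw//; ring.
- apply: (is_derive_eq (is_derive_profile i0 vC2 r)).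
  by rewrite mulrA pw// addNr powRr0 mul1r.
- apply: (is_derive_eq (is_derive_profile i0 uC2 r)).
  by rewrite mulrA pw// addNr powRr0 mul1r.
Qed.

(** * Return to limits in space and conclusion *)

Lemma cvg_enorm_oo (R : realType) (n : nat) :
  enorm x @[x --> @enorm_oo R n] --> +oo.
Proof. by move=> P [M [_ MP]]; exists M => // x; exact: MP. Qed.

Lemma radial_power_cvg (R : realType) (n : nat) (i0 : 'I_n)
    (f : 'rV[R]_n -> R) (c e : R) :
  c != 0 -> radially_symmetric f ->
  f (r *: delta_mx 0 i0) / (c * r `^ e) @[r --> +oo] --> (1 : R) ->
  f x / enorm x `^ e @[x --> @enorm_oo R n] --> c.
Proof.
move=> c0 frad fc.
have H := cvgM (cvg_cst c) (cvg_comp _ _ (@cvg_enorm_oo R n) fc).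
rewrite -[X in _ --> X]mulr1.
have -> : (fun x => f x / enorm x `^ e) =
    fun x => c * (f (enorm x *: delta_mx 0 i0) / (c * enorm x `^ e)).
  apply/funext => x; rewrite (frad (enorm x *: delta_mx 0 i0) x).
    by rewrite invfM mulrCA mulVKf.
  by rewrite enorm_axis// sqrtr_ge0.
exact: H.
Qed.

Theorem theorem2p3 (R : realType) (N : nat) (a b p q s : R)
    (u v : 'rV[R]_N -> R)
    (hN : (2 <= N)%N)
    (ha : 0 < a) (hb : 0 < b) (hp : 0 < p) (hq : 0 < q) (hs : 1 <= s)
    (hp1 : p < 1) (hpsq : p * s + q < 1)
    (huv : positive_radial_solution a b p q s u v)
    (hcond : p * (s - 2) * (s + a * s + b + 2) / (1 - p * s - q)
             <= 2 * (N%:R + a - 1)) :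
  let A := 2 + (b + 2 * q + s * (1 + a + 2 * p)) / (1 - p * s - q) in
  let B := N%:R + a
    + p * (2 + (b + 2 * q + s * (1 + a + 2 * p)) / (1 - p * s - q)) in
  let K := N%:R + (b + 2 * q + s * (1 + a + 2 * p)) / (1 - p * s - q) in
  let D := 2 + a
    + p * (2 + (b + 2 * q + s * (1 + a + 2 * p)) / (1 - p * s - q)) in
  (u x / enorm x `^ (((a + 2) * (1 - p * s - q) + p * s * (a + 1)
                       + b * p + 2 * p) / (1 - p * s - q))
     @[x --> @enorm_oo R N]
     --> (A * B `^ s * K) `^ (p / (p * s + q - 1)) / (D * B))
  /\
  (v x / enorm x `^ (((a + 1) * s + b + 2) / (1 - p * s - q))
     @[x --> @enorm_oo R N]
     --> (A * B `^ s * K) `^ (1 / (p * s + q - 1))).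
Proof.
move=> A B K D.
have th1 : 0 < 1 - p * s - q by lra.
have th1n : 1 - p * s - q != 0 by rewrite gt_eqF.
have s0 : 0 < s by lra.
have N2 : (2 : R) <= N%:R by rewrite ler_nat.
have A2 : 2 < A.
  rewrite /A ltrDl divr_gt0// addr_gt0 ?mulr_gt0//; first by lra.
  by rewrite !addr_gt0 ?mulr_gt0.
have pA0 : 0 < p * A by rewrite mulr_gt0//; lra.
pose m : R := N%:R - 1.
have A0 : 0 < A by lra.
have B0 : 0 < B by rewrite /B -/A; lra.
have KE : K = A - 1 + m by rewrite /K /A /m; ring.
have K0 : 0 < K by rewrite KE /m; lra.
have D0 : 0 < D by rewrite /D -/A; lra.
(* The closed formula for [A] solves this linear equation, the balance of powers around the
   cycle. *)
have AE : A = 2 + b + s * (1 + a) + (p * s + q) * A by rewrite /A; field.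
have BE : B = m + 1 + a + p * A by rewrite /B /m -/A; ring.
set X := A * B `^ s * K.
have X0 : 0 < X by rewrite !mulr_gt0// powR_gt0.
(* This is the positive root of [X * c = c] to the power [p * s + q], the balance of
   coefficients. *)
pose c := X `^ (1 / (p * s + q - 1)).
have c0 : 0 < c by rewrite powR_gt0.
have e1n : p * s + q - 1 != 0 by rewrite lt_eqF//; lra.
have cE : X * c = c `^ (p * s + q).
  rewrite -{1}(powRr1 (ltW X0)) /c -powRrM -powRD ?(gt_eqF X0) ?implybT//.
  by congr (_ `^ _); field.
have cpE : X `^ (p / (p * s + q - 1)) = c `^ p.
  by rewrite /c -powRrM; congr (_ `^ _); field.
have SOL := power_system_solution c0 A0 B0 K0 D0 AE BE KE (erefl D) cE.
pose i0 : 'I_N := Ordinal (ltnW hN).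
have sol := radial_system_solution i0 hN huv.
case: huv => _ [urad vrad] _ _ _.
have C0 : 0 < c `^ p / (D * B) by rewrite divr_gt0 ?powR_gt0// mulr_gt0.
have pos (e r : R) : 0 < r -> 0 < r `^ e by exact: powR_gt0.
have [] := system_ratio_cvg hp hq s0 hpsq (pos _) (pos _) (pos _) sol SOL.
- exact: cvg_scale_powR_pinfty.
- exact: cvg_scale_powR_pinfty.
- by apply: cvg_scale_powR_pinfty => //; rewrite divr_gt0// powR_gt0.
- by apply: cvg_scale_powR_pinfty => //; rewrite mulr_gt0.
move=> /(radial_power_cvg (lt0r_neq0 C0) urad) Hu.
move=> /(radial_power_cvg (lt0r_neq0 c0) vrad) Hv.
rewrite cpE; split.
(* The stated growth exponents of u and v are [D] and [A] put over the common denominator. *)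
- suff <- : D = ((a + 2) * (1 - p * s - q) + p * s * (a + 1) + b * p + 2 * p)
    / (1 - p * s - q) by [].
  by rewrite /D; field.
- suff <- : A = ((a + 1) * s + b + 2) / (1 - p * s - q) by [].
  by rewrite /A; field.
Qed.
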